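(* With data, cone $K$ and constants $M_i$, $c_{\gamma_i}$ as in the context, assume that for $i=1,2$ there exist $A_i>0$ and $\lambda_i>0$ such that for $f_i:[0,+\infty)\times\mathbb R\to[0,+\infty)$ one has - $H_i[u_1,u_2]\ge A_i\|u_i\|$ for all $(u_1,u_2)\in K$, - $f_i(z_1,z_2)\ge\lambda_iM_iz_i$ for all $(z_1,z_2)\in[0,+\infty)\times\mathbb R$, - $c_{\gamma_i}\|\gamma_i\|A_i+\lambda_i>1$. Then the system $$u(t)=\gamma_1(t)H_1[u,v]+\int_0^1k_1(t,s)g_1(s)f_1(u(s),v(s))\,ds,\qquad v(t)=\gamma_2(t)H_2[u,v]+\int_0^1k_2(t,s)g_2(s)f_2(u(s),v(s))\,ds,\qquad t\in[0,1],$$ has no nontrivial solution in $K$, i.e. no solution $(u,v)\in K$ with $\|(u,v)\|>0$.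
   Context: **Data.** Let $n\ge 3$, $R_1>0$, $R_\eta,R_\xi\in(R_1,+\infty)$, $\beta_1,\delta_1\in\mathbb R$. For $t\in(0,1]$ put $r(t)=R_1t^{\frac1{2-n}}$ and $\phi(t)=r(t)\frac{R_1}{(n-2)^2}t^{\frac{2n-3}{2-n}}$. Let $\eta,\xi\in(0,1)$ be such that $r(\eta)=R_\eta$, $r(\xi)=R_\xi$, and put $\beta_2=(2-n)\delta_1\frac{\xi}{R_\xi}$. Assume $1\le\beta_1<\frac1\eta$ and $0\le\beta_2<1-\xi$. For $i=1,2$: $f_i$ is continuous; $h_i:[R_1,+\infty)\to[0,+\infty)$ is continuous and, for some $\mu_i>0$, $h_i(\rho)\le\rho^{-(n+\mu_i)}$ for all sufficiently large $\rho$; $g_i(t)=\phi(t)h_i(r(t))$. **Kernels.** $$k_1(t,s)=\frac{t(1-s)}{1-\beta_1\eta}-\begin{cases}\frac{\beta_1t(\eta-s)}{1-\beta_1\eta},&s\le\eta\\0,&s>\eta\end{cases}-\begin{cases}t-s,&s\le t\\0,&s>t\end{cases}$$ $$k_2(t,s)=\frac{t(1-s)}{1-\beta_2}-\begin{cases}\frac{\beta_2t}{1-\beta_2},&s\le\xi\\0,&s>\xi\end{cases}-\begin{cases}t-s,&s\le t\\0,&s>t\end{cases}$$ $$\gamma_1(t)=1+\frac{(\beta_1-1)t}{1-\beta_1\eta},\quad \gamma_2(t)=1-\frac t{1-\beta_2},\quad \Phi_1(s)=\frac{\beta_1s(1-s)}{1-\beta_1\eta},\quad \Phi_2(s)=\max\{1,\beta_2/\xi\}\frac{s(1-s)}{1-\beta_2}.$$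 **Constants.** Fix intervals $[a_1,b_1]\subset(0,1]$, $[a_2,b_2]\subset(0,1-\beta_2)$ and assume $\int_{a_i}^{b_i}\Phi_i(s)g_i(s)\,ds>0$ for $i=1,2$. Put $$c_{k_1}=\min\{a_1\eta,4a_1(1-\beta_1\eta)\eta,\eta(1-\beta_1\eta)\},\quad c_{k_2}=\frac{\min\{4a_2(1-\beta_2-\xi),\,1-b_2-\beta_2\}}{\max\{1,\beta_2/\xi\}},$$ $$c_{\gamma_1}=\frac{\beta_1-1}{\beta_1(1-\eta)}a_1+\frac{1-\beta_1\eta}{\beta_1(1-\eta)},\qquad c_{\gamma_2}=\begin{cases}\frac{1-\beta_2}{\beta_2}-\frac{b_2}{\beta_2},&\beta_2\ge1/2\\1-\frac{b_2}{1-\beta_2},&\beta_2\le1/2\end{cases}$$ and $c_i=\min\{c_{k_i},c_{\gamma_i}\}$. Put $\frac1{M_i}=\inf_{t\in[a_i,b_i]}\int_{a_i}^{b_i}k_i(t,s)g_i(s)\,ds$. **Cone.** $\|w\|=\max_{[0,1]}|w|$ on $C[0,1]$, $\|(u,v)\|=\max\{\|u\|,\|v\|\}$, and $K_1=\{w\in C[0,1]:w\ge0,\ \min_{[a_1,b_1]}w\ge c_1\|w\|\}$, $K_2=\{w\in C[0,1]:\min_{[a_2,b_2]}w\ge c_2\|w\|\}$, $K=K_1\times K_2$. For $i=1,2$, $H_i:K\to[0,\infty)$ is a compact functional (continuous, mapping bounded sets to relatively compact sets). *)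

(* Defs.v *)
From HB Require Import structures.
From mathcomp Require Export all_boot all_order all_algebra.
From mathcomp Require Export all_classical all_reals all_analysis.

Set Implicit Arguments.
Unset Strict Implicit.
Unset Printing Implicit Defensive.

Export Order.TTheory GRing.Theory Num.Theory.
Export numFieldNormedType.Exports.

Local Open Scope classical_set_scope.
Local Open Scope ring_scope.

Definition radius (R : realType) (n : nat) (R1 t : R) : R :=
  R1 * t `^ (1 / (2 - n%:R)).

Definition phi (R : realType) (n : nat) (R1 t : R) : R :=
  radius n R1 t * (R1 / (n%:R - 2) ^+ 2)
    * t `^ ((2 * n%:R - 3) / (2 - n%:R)).

(* The paper's weights live on (0,1]; at t = 0 the convention 0 `^ x = 0 for
   x <> 0 makes gweight vanish, and a single point does not affect integrals. *)
Definition gweight (R : realType) (n : nat) (R1 : R) (h : R -> R) (t : R) : R :=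
  phi n R1 t * h (radius n R1 t).

Definition k1 (R : realType) (beta eta t s : R) : R :=
  t * (1 - s) / (1 - beta * eta)
  - (if s <= eta then beta * t * (eta - s) / (1 - beta * eta) else 0)
  - (if s <= t then t - s else 0).

Definition k2 (R : realType) (beta xi t s : R) : R :=
  t * (1 - s) / (1 - beta)
  - (if s <= xi then beta * t / (1 - beta) else 0)
  - (if s <= t then t - s else 0).

Definition gamma1 (R : realType) (beta eta t : R) : R :=
  1 + (beta - 1) * t / (1 - beta * eta).

Definition gamma2 (R : realType) (beta t : R) : R := 1 - t / (1 - beta).

Definition Phi1 (R : realType) (beta eta s : R) : R :=
  beta * s * (1 - s) / (1 - beta * eta).

Definition Phi2 (R : realType) (beta xi s : R) : R :=
  Num.max 1 (beta / xi) * (s * (1 - s) / (1 - beta)).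

Definition ck1 (R : realType) (beta eta a : R) : R :=
  Num.min (Num.min (a * eta) (4 * a * (1 - beta * eta) * eta))
          (eta * (1 - beta * eta)).

Definition ck2 (R : realType) (beta xi a b : R) : R :=
  Num.min (4 * a * (1 - beta - xi)) (1 - b - beta) / Num.max 1 (beta / xi).

Definition cgamma1 (R : realType) (beta eta a : R) : R :=
  (beta - 1) / (beta * (1 - eta)) * a + (1 - beta * eta) / (beta * (1 - eta)).

Definition cgamma2 (R : realType) (beta b : R) : R :=
  if 1 / 2 <= beta then (1 - beta) / beta - b / beta else 1 - b / (1 - beta).

Definition c1 (R : realType) (beta eta a : R) : R :=
  Num.min (ck1 beta eta a) (cgamma1 beta eta a).

Definition c2 (R : realType) (beta xi a b : R) : R :=
  Num.min (ck2 beta xi a b) (cgamma2 beta b).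

(* The constant M with 1/M = inf_{t in [a,b]} int_a^b k(t,s) g(s) ds. *)
Definition Mconst (R : realType) (k : R -> R -> R) (g : R -> R) (a b : R) : R :=
  (inf [set \int[lebesgue_measure]_(s in `[a, b]) (k t s * g s)
        | t in `[a, b]])^-1.

(* An element of C[0,1] is represented by a total function on R whose
   restriction to [0,1] is continuous.  The topology of {uniform` [0,1] -> R}
   is that of the sup-norm over [0,1] and does not separate functions agreeing
   on [0,1]; a functional continuous for it therefore depends only on
   restrictions to [0,1]. *)
Notation funI R := {uniform` `[(0 : R), (1 : R)]%classic -> R}.

Definition supnorm (R : realType) (w : R -> R) : R :=
  sup [set `|w t| | t in `[0, 1]].

Definition pairnorm (R : realType) (p : funI R * funI R) : R :=
  Num.max (supnorm p.1) (supnorm p.2).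

Definition cone1 (R : realType) (a b c : R) : set (funI R) :=
  [set w : R -> R | [/\ {within `[0, 1], continuous w},
     forall t, t \in `[0, 1] -> 0 <= w t
   & inf [set w t | t in `[a, b]] >= c * supnorm w]].

Definition cone2 (R : realType) (a b c : R) : set (funI R) :=
  [set w : R -> R | {within `[0, 1], continuous w} /\
     inf [set w t | t in `[a, b]] >= c * supnorm w].

Definition cone (R : realType) (beta1 beta2 eta xi a1 b1 a2 b2 : R) :
    set (funI R * funI R) :=
  cone1 a1 b1 (c1 beta1 eta a1) `*` cone2 a2 b2 (c2 beta2 xi a2 b2).

Definition compact_functional (R : realType) (K : set (funI R * funI R))
    (H : funI R * funI R -> R) : Prop :=
  [/\ forall p, K p -> 0 <= H p,
      {within K, continuous H}
    & forall B : set (funI R * funI R), B `<=` K ->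
        (exists r : R, forall p, B p -> pairnorm p <= r) ->
        precompact (H @` B)].

Definition admissible_h (R : realType) (n : nat) (R1 : R) (h : R -> R) : Prop :=
  [/\ {within `[R1, +oo[, continuous h},
      forall rho, R1 <= rho -> 0 <= h rho
    & exists2 mu : R, 0 < mu &
        \forall rho \near +oo, h rho <= rho `^ (- (n%:R + mu))].

Definition admissible_f (R : realType) (f : R * R -> R) : Prop :=
  {within `[0, +oo[ `*` setT, continuous f} /\
  forall z1 z2, 0 <= z1 -> 0 <= f (z1, z2).

Definition is_solution (R : realType) (k1 k2 : R -> R -> R)
    (gamma1 gamma2 g1 g2 : R -> R) (f1 f2 : R * R -> R)
    (H1 H2 : funI R * funI R -> R) (u v : funI R) : Prop :=
  forall t, t \in `[0, 1] ->
    u t = gamma1 t * H1 (u, v)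
          + \int[lebesgue_measure]_(s in `[0, 1])
              (k1 t s * g1 s * f1 (u s, v s)) /\
    v t = gamma2 t * H2 (u, v)
          + \int[lebesgue_measure]_(s in `[0, 1])
              (k2 t s * g2 s * f2 (u s, v s)).

(* Main.v *)
From mathcomp Require Import measurable_realfun ring lra.
Require Import Defs.

Local Open Scope classical_set_scope.
Local Open Scope ring_scope.
Set Implicit Arguments.
Unset Strict Implicit.
Unset Printing Implicit Defensive.

(** Suppose that the component [u] of a solution in the cone has positive norm,
and let [sg] be its infimum over [[a1, b1]]. The cone condition gives
[sg >= c1 * ||u|| > 0]. For [t] in [[a1, b1]] the equation for [u] bounds [u t]
from below by two terms. The boundary term [gamma1 t * H1] is at least
[cgamma1 * ||gamma1|| * A1 * ||u||], because [gamma1 >= cgamma1 * ||gamma1||] on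
[[a1, b1]] ([gamma1_ge]), and hence at least [cgamma1 * ||gamma1|| * A1 * sg].
Since the kernel is nonnegative for such [t], the integral may be shrunk to
[[a1, b1]], where [f1 >= lambda1 * M1 * sg]; it is then at least
[lambda1 * sg], because [M1 * \int k1 g1 >= 1] by definition of [M1].
Altogether [u t >= q * sg] with [q > 1], and taking the infimum over [t] gives
[sg >= q * sg], which is absurd. The component [v] is treated in the same way on
[[a2, b2]], where [k2] is nonnegative too; [no_cone_fixed_point] is the common
argument.

Two analytic points support this. First, [M1] has to be the inverse of a
positive number: [k1 t s >= c * (s * (1 - s))] with [c > 0] ([k1_bounds],
[k2_bounds]), so the positive mass of [Phi1 * g1] bounds the infimum defining
[M1] away from zero ([Mconst_mul_ge1]). Secondly, the integrals must converge,
although [g1] may be unbounded at [0]. The kernels vanish there, with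
[k t s <= C * s], and in the variable [rho = radius s] the product
[s * gweight s] is a multiple of [rho ^ n * h rho], which the decay of [h] keeps
bounded ([mul_gweight_bounded]); so [k t s * gweight s] is a bounded function
of [s]. *)

(** * Kernels *)

(** The lower bound carries the nonnegativity of the kernel and the comparison
with [Phi1] and [Phi2], which are positive multiples of [s * (1 - s)]. The upper
bound records the vanishing at [s = 0] that compensates the singularity of the
weight. *)
Definition kernel_bounds (R : realType) (k : R -> R -> R) (a b c C : R) : Prop :=
  forall t s, a <= t <= b -> 0 <= s <= 1 -> c * (s * (1 - s)) <= k t s <= C * s.

Lemma quotient_bounds (R : realType) (x N D C s : R) :
  0 < D -> x * D <= N <= C * s -> x <= N / D <= C / D * s.
Proof.
by move=> D0; rewrite ler_pdivlMr// [C / D * s]mulrAC ler_pM2r ?invr_gt0.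
Qed.

(** Multiplied by [D = 1 - beta * eta], the kernel takes one of four values,
according to the position of [s] with respect to [eta] and [t]:
[s * ((beta - 1) * t + D)], [t * (D + s * (beta - 1))],
[s * (1 - t) + beta * eta * (t - s)] and [t * (1 - s)]. Each of them is a sum of
nonnegative terms, to be compared with multiples of [s]; the smaller constant
[a * eta] in place of [ck1] serves all four cases at once. *)
Lemma k1_bounds (R : realType) (beta eta a b : R) :
  0 < eta < 1 -> 1 <= beta < 1 / eta -> 0 < a -> b <= 1 ->
  kernel_bounds (k1 beta eta) a b (a * eta) ((1 + beta) / (1 - beta * eta)).
Proof.
move=> /andP[eta0 eta1] /andP[beta1]; rewrite ltr_pdivlMr// => betaeta a0 b1.
move=> t s /andP[at_ tb] /andP[s0 s1]; have t1 := le_trans tb b1.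
have [t0 a1] : 0 <= t /\ a <= 1 by lra.
have [beta0 bm] : 0 <= beta /\ 0 <= beta - 1 by lra.
have [u0 u1] : 0 <= 1 - s /\ 1 - s <= 1 by lra.
have be0 : 0 <= beta * eta by rewrite mulr_ge0// ltW.
have D0 : 0 < 1 - beta * eta by rewrite subr_gt0.
have Dn : 1 - beta * eta != 0 by rewrite gt_eqF.
have D1 : 1 - beta * eta <= 1 by rewrite gerBl.
have c_a : a * eta <= a by rewrite ler_piMr// ltW.
have c_eta : a * eta <= eta by rewrite ler_piMl// ltW.
have c0 : 0 <= a * eta by rewrite mulr_ge0// ltW.
have X0 : 0 <= s * (1 - s) by rewrite mulr_ge0.
have Xs : s * (1 - s) <= s by rewrite ler_piMr.
have cXs : a * eta * (s * (1 - s)) <= s.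
  by rewrite (le_trans _ Xs)// ler_piMl// (le_trans c_a).
have cXt : a * eta * (s * (1 - s)) <= t.
  by rewrite (le_trans _ at_)// (le_trans _ c_a)// ler_piMr// (le_trans Xs).
have cXD : a * eta * (s * (1 - s)) * (1 - beta * eta) <= a * eta * (s * (1 - s)).
  by rewrite ler_piMr// mulr_ge0.
have Cs : s <= (1 + beta) * s by rewrite ler_peMl// lerDl.
rewrite /k1; case: (lerP s eta) => se; case: (lerP s t) => st.
- rewrite (_ : _ - _ - _ = s * ((beta - 1) * t + (1 - beta * eta)) / (1 - beta * eta));
    last by field.
  apply: quotient_bounds => //; apply/andP; split.
    apply: (@le_trans _ _ (s * (1 - beta * eta))); first by rewrite ler_wpM2r// ltW.
    by rewrite ler_wpM2l// lerDr mulr_ge0.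
  have h : (beta - 1) * t <= beta - 1 by rewrite ler_piMr.
  by rewrite mulrC ler_wpM2r//; clear -h D1; lra.
- rewrite (_ : _ - _ - _ = t * (1 - beta * eta + s * (beta - 1)) / (1 - beta * eta));
    last by field.
  have h : s * (beta - 1) <= beta - 1 by rewrite ler_piMl.
  apply: quotient_bounds => //; apply/andP; split.
    apply: (@le_trans _ _ (t * (1 - beta * eta))); first by rewrite ler_wpM2r// ltW.
    by rewrite ler_wpM2l// lerDl mulr_ge0.
  rewrite mulrC; apply: ler_pM => //; last exact: ltW.
    by rewrite addr_ge0 ?mulr_ge0// ltW.
  by clear -h D1; lra.
- rewrite (_ : _ - _ - _ = (s * (1 - t) + beta * eta * (t - s)) / (1 - beta * eta));
    last by field.
  have [v0 v1] : 0 <= 1 - t /\ 1 - t <= 1 by clear -t0 t1; lra.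
  have [w0 w1] : 0 <= t - s /\ t - s <= 1 by clear -st s0 t1; lra.
  apply: quotient_bounds => //; apply/andP; split.
    apply: (le_trans cXD); apply: (@le_trans _ _ (eta * (s * (1 - s)))).
      by rewrite ler_wpM2r.
    (* Split [1 - s] as [(1 - t) + (t - s)] to compare term by term. *)
    rewrite (_ : eta * _ = eta * (s * (1 - t)) + eta * s * (t - s)); last by ring.
    rewrite lerD//; first by rewrite ler_piMl ?mulr_ge0// ltW.
    by rewrite ler_wpM2r// mulrC ler_wpM2r ?(le_trans s1)// ltW.
  rewrite mulrDl mul1r lerD//; first by rewrite ler_piMr.
  by rewrite -mulrA ler_wpM2l// (le_trans _ (ltW se))// ler_piMr// ltW.
- rewrite (_ : _ - _ - _ = (t * (1 - s)) / (1 - beta * eta)); last by field.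
  apply: quotient_bounds => //; apply/andP; split.
    apply: (le_trans cXD); rewrite mulrA ler_wpM2r// (le_trans _ at_)//.
    by rewrite (le_trans _ c_a)// ler_piMr.
  by rewrite (le_trans _ Cs)// (le_trans _ (ltW st))// ler_piMr.
Qed.

(** With [D = 1 - beta], the four values of [D * k2] are [s * (D - t)],
[t * (D - s)], [s * (1 - t) + beta * (t - s)] and [t * (1 - s)]. The first one
changes sign at [t = D], whence the restriction to [b < 1 - beta]. The constant
is a product of three factors below [1], so that each case can retain the factors
it needs. *)
Lemma k2_bounds (R : realType) (beta xi a b : R) :
  0 < xi < 1 -> 0 <= beta < 1 - xi -> 0 < a -> b < 1 - beta ->
  kernel_bounds (k2 beta xi) a b (a * (1 - beta - xi) * (1 - beta - b))
    ((1 + xi^-1) / (1 - beta)).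
Proof.
move=> /andP[xi0 xi1] /andP[beta0 betaxi] a0 bb.
move=> t s /andP[at_ tb] /andP[s0 s1].
have [t0 t1] : 0 <= t /\ t <= 1 by lra.
have [u0 u1] : 0 <= 1 - s /\ 1 - s <= 1 by lra.
have [D0 D1] : 0 < 1 - beta /\ 1 - beta <= 1 by lra.
have [P0 P1] : 0 <= 1 - beta - xi /\ 1 - beta - xi <= 1 by lra.
have [Q0 Q1] : 0 <= 1 - beta - b /\ 1 - beta - b <= 1 by lra.
have Qt : 1 - beta - b <= 1 - beta - t by lra.
have [a1 Qt'] : a <= 1 /\ 1 - beta - b <= 1 - t by lra.
have Dn : 1 - beta != 0 by rewrite gt_eqF.
have xiV : 0 < xi^-1 by rewrite invr_gt0.
have X0 : 0 <= s * (1 - s) by rewrite mulr_ge0.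
have Xs : s * (1 - s) <= s by rewrite ler_piMr.
have aP0 : 0 <= a * (1 - beta - xi) by rewrite mulr_ge0// ltW.
have aP : a * (1 - beta - xi) <= a by rewrite ler_piMr// ltW.
have aP1 := le_trans aP a1.
set c := a * _ * _.
have c0 : 0 <= c by rewrite mulr_ge0.
have cP : c <= a * (1 - beta - xi) by rewrite ler_piMr.
have cQ : c <= 1 - beta - b by rewrite ler_piMl.
have cXD : c * (s * (1 - s)) * (1 - beta) <= c * (s * (1 - s)).
  by rewrite ler_piMr// mulr_ge0.
have cXQ : c * (s * (1 - s)) <= s * (1 - beta - b).
  by rewrite mulrC; apply: ler_pM.
have Cs : s <= (1 + xi^-1) * s by rewrite ler_peMl// lerDl ltW.
rewrite /k2; case: (lerP s xi) => sx; case: (lerP s t) => st.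
- rewrite (_ : _ - _ - _ = s * (1 - beta - t) / (1 - beta)); last by field.
  apply: quotient_bounds => //; apply/andP; split.
    by rewrite (le_trans cXD)// (le_trans cXQ)// ler_wpM2l.
  by rewrite (le_trans _ Cs)// ler_piMr//; clear -t0 beta0; lra.
- rewrite (_ : _ - _ - _ = t * (1 - s - beta) / (1 - beta)); last by field.
  have Ps : 1 - beta - xi <= 1 - s - beta by clear -sx; lra.
  apply: quotient_bounds => //; apply/andP; split.
    apply: (le_trans cXD); apply: (@le_trans _ _ c).
      by rewrite ler_piMr// (le_trans Xs).
    by rewrite (le_trans cP)//; apply: ler_pM => //; exact: ltW.
  rewrite (le_trans _ Cs)// (le_trans _ (ltW st))// ler_piMr//.
  by clear -s0 beta0; lra.
- rewrite (_ : _ - _ - _ = (s * (1 - t) + beta * (t - s)) / (1 - beta)); last by field.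
  have [v0 v1] : 0 <= 1 - t /\ 1 - t <= 1 by clear -t0 t1; lra.
  have [w0 w1] : 0 <= t - s /\ t - s <= 1 by clear -st s0 t1; lra.
  apply: quotient_bounds => //; apply/andP; split.
    rewrite (le_trans cXD)// (le_trans cXQ)//.
    by rewrite -[leLHS]addr0 lerD ?mulr_ge0// ler_wpM2l.
  rewrite mulrDl mul1r lerD//; first by rewrite ler_piMr.
  (* [k2] jumps at [s = xi], so beyond [xi] the bound by a multiple of [s] has
     to use [1 <= s / xi]. *)
  apply: (@le_trans _ _ 1); last by rewrite ler_pdivlMl// mulr1 ltW.
  by rewrite mulr_ile1//; clear -D0; lra.
- rewrite (_ : _ - _ - _ = (t * (1 - s)) / (1 - beta)); last by field.
  apply: quotient_bounds => //; apply/andP; split.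
    apply: (le_trans cXD); rewrite mulrA ler_wpM2r// (le_trans _ at_)//.
    by rewrite (le_trans _ aP)// (le_trans _ cP)// ler_piMr.
  by rewrite (le_trans _ Cs)// (le_trans _ (ltW st))// ler_piMr.
Qed.

Lemma measurable_threshold (R : realType) (d : R) (p : R -> R) :
  measurable_fun [set: R] p ->
  measurable_fun [set: R] (fun s => if s <= d then p s else 0).
Proof. by move=> mp; apply: measurable_fun_ifT => //; exact: measurable_fun_ler. Qed.

Lemma measurable_k1 (R : realType) (beta eta t : R) :
  measurable_fun [set: R] (k1 beta eta t).
Proof.
apply: measurable_funB; first apply: measurable_funB.
- by do 2 apply: measurable_funM => //; apply: measurable_funB.
- apply: measurable_threshold; do 2 apply: measurable_funM => //.
  exact: measurable_funB.
- by apply: measurable_threshold; exact: measurable_funB.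
Qed.

Lemma measurable_k2 (R : realType) (beta xi t : R) :
  measurable_fun [set: R] (k2 beta xi t).
Proof.
apply: measurable_funB; first apply: measurable_funB.
- by do 2 apply: measurable_funM => //; apply: measurable_funB.
- exact: measurable_threshold.
- by apply: measurable_threshold; exact: measurable_funB.
Qed.

(** * Boundary profiles and cone constants *)

(** The bound [B] is needed because [supnorm] is [0] on functions that are
unbounded on the unit interval. *)
Lemma supnorm_ge (R : realType) (w : R -> R) (B t : R) :
  (forall s, 0 <= s <= 1 -> `|w s| <= B) -> 0 <= t <= 1 -> `|w t| <= supnorm w.
Proof.
move=> wB t01; apply: ub_le_sup; last by exists t => //=; rewrite in_itv.
by exists B => _ [s /= s01 <-]; apply: wB; rewrite in_itv in s01.
Qed.

Lemma supnorm_ge0 (R : realType) (w : R -> R) : 0 <= supnorm w.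
Proof.
rewrite /supnorm; have [sw|nsw] := pselect (has_sup [set `|w t| | t in `[0, 1]]).
  apply: (@le_trans _ _ `|w 0|) => //; apply: ub_le_sup; first by case: sw.
  by exists 0 => //=; rewrite in_itv/= lexx ler01.
by rewrite sup_out.
Qed.

Lemma supnorm_le (R : realType) (w : R -> R) (B : R) :
  (forall s, 0 <= s <= 1 -> `|w s| <= B) -> supnorm w <= B.
Proof.
move=> wB; apply: ge_sup; first by exists `|w 0|, 0 => //=; rewrite in_itv/= lexx ler01.
by move=> _ [s /= s01 <-]; apply: wB; rewrite in_itv in s01.
Qed.

(** The profile is nondecreasing, so that its norm is its value at [1]; then
[cgamma1] is exactly the ratio between the values at [a] and at [1]. *)
Lemma gamma1_ge (R : realType) (beta eta a t : R) :
  0 < eta < 1 -> 1 <= beta < 1 / eta -> 0 < a -> a <= t ->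
  cgamma1 beta eta a * supnorm (gamma1 beta eta) <= gamma1 beta eta t.
Proof.
move=> /andP[eta0 eta1] /andP[beta1]; rewrite ltr_pdivlMr// => betaeta a0 at_.
have D0 : 0 < 1 - beta * eta by rewrite subr_gt0.
have Dn : 1 - beta * eta != 0 by rewrite gt_eqF.
have en : 1 - eta != 0 by rewrite gt_eqF// subr_gt0.
have bn : beta != 0 by rewrite gt_eqF//; lra.
have mono x y : x <= y -> gamma1 beta eta x <= gamma1 beta eta y.
  move=> xy; rewrite /gamma1 lerD2l ler_pM2r ?invr_gt0// ler_wpM2l// subr_ge0//.
have nrm : supnorm (gamma1 beta eta) <= gamma1 beta eta 1.
  apply: supnorm_le => s /andP[s0 s1]; rewrite ger0_norm ?mono//.
  by apply: (@le_trans _ _ (gamma1 beta eta 0)); rewrite ?mono// /gamma1 mulr0 mul0r addr0.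
apply: (@le_trans _ _ (cgamma1 beta eta a * gamma1 beta eta 1)).
  rewrite ler_wpM2l// /cgamma1 addr_ge0// ?mulr_ge0// ?invr_ge0 ?mulr_ge0//; lra.
apply: (le_trans _ (mono _ _ at_)).
by rewrite /cgamma1 /gamma1 le_eqVlt; apply/orP; left; apply/eqP; field; apply/and3P.
Qed.

(** The profile decreases from [1] at [0] to [- beta / (1 - beta)] at [1], so its
norm is the larger of [1] and [beta / (1 - beta)]; this explains the case
distinction at [beta = 1 / 2] in [cgamma2], which is the ratio between the value
at [b] and that norm. *)
Lemma gamma2_ge (R : realType) (beta b t : R) :
  0 <= beta < 1 -> b < 1 - beta -> t <= b ->
  cgamma2 beta b * supnorm (gamma2 beta) <= gamma2 beta t.
Proof.
move=> /andP[beta0 beta1] bb tb.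
have D0 : 0 < 1 - beta by lra.
have Dn : 1 - beta != 0 by rewrite gt_eqF.
have mono x y : x <= y -> gamma2 beta y <= gamma2 beta x.
  by move=> xy; rewrite /gamma2 lerD2l lerN2 ler_pM2r ?invr_gt0.
have g1E : gamma2 beta 1 = - (beta / (1 - beta)) by rewrite /gamma2; field.
have g0E : gamma2 beta 0 = 1 by rewrite /gamma2 mul0r subr0.
have nrm B : 1 <= B -> beta / (1 - beta) <= B -> supnorm (gamma2 beta) <= B.
  move=> B1 B2; apply: supnorm_le => s /andP[s0 s1].
  have := mono _ _ s0; have := mono _ _ s1; rewrite g1E g0E => h1 h2.
  by rewrite ler_norml; apply/andP; split; [lra|lra].
apply: (le_trans _ (mono _ _ tb)).
rewrite /cgamma2; case: ifPn => [half|]; last rewrite -ltNge => half.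
  have bn : beta != 0 by rewrite gt_eqF//; lra.
  apply: (@le_trans _ _ (((1 - beta) / beta - b / beta) * (beta / (1 - beta)))).
    rewrite ler_wpM2l//; first by rewrite -mulrBl mulr_ge0 ?invr_ge0//; lra.
    by apply: nrm => //; rewrite ler_pdivlMr//; lra.
  by rewrite /gamma2 le_eqVlt; apply/orP; left; apply/eqP; field; apply/andP.
rewrite -/(gamma2 beta b) ler_piMr//.
  by rewrite /gamma2 subr_ge0 ler_pdivrMr//; lra.
by apply: nrm => //; rewrite ler_pdivrMr//; lra.
Qed.

Lemma c1_gt0 (R : realType) (beta eta a : R) :
  0 < eta < 1 -> 1 <= beta < 1 / eta -> 0 < a -> 0 < c1 beta eta a.
Proof.
move=> /andP[eta0 eta1] /andP[beta1]; rewrite ltr_pdivlMr// => betaeta a0.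
have D0 : 0 < 1 - beta * eta by rewrite subr_gt0.
have E0 : 0 < beta * (1 - eta) by rewrite mulr_gt0//; lra.
rewrite /c1 /ck1 /cgamma1 !lt_min !mulr_gt0//=.
by rewrite ltr_wpDl ?divr_gt0// !mulr_ge0 ?invr_ge0 ?subr_ge0// ltW.
Qed.

Lemma c2_gt0 (R : realType) (beta xi a b : R) :
  0 < xi < 1 -> 0 <= beta < 1 - xi -> 0 < a -> a <= b -> b < 1 - beta ->
  0 < c2 beta xi a b.
Proof.
move=> /andP[xi0 xi1] /andP[beta0 betaxi] a0 ab bb.
have P0 : 0 < 1 - beta - xi by lra.
have Q0 : 0 < 1 - b - beta by lra.
rewrite /c2 lt_min; apply/andP; split.
  rewrite /ck2 divr_gt0//; last by rewrite lt_max ltr01.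
  by rewrite lt_min Q0 andbT !mulr_gt0.
rewrite /cgamma2; case: ifPn => [half|]; last rewrite -ltNge => half.
  by rewrite -mulrBl divr_gt0//; lra.
by rewrite subr_gt0 ltr_pdivrMr//; lra.
Qed.

(** * Continuity and integration on intervals *)

Lemma within_continuous_bounded (R : realType) (f : R -> R) (a b : R) :
  {within `[a, b], continuous f} ->
  exists2 B, 0 <= B & forall x, a <= x <= b -> `|f x| <= B.
Proof.
move=> fc; have /compact_bounded [N [_ Nf]] :=
  continuous_compact fc (@segment_compact _ a b).
exists (`|N| + 1); first by rewrite addr_ge0.
move=> x xab; apply: Nf; first by rewrite (le_lt_trans (ler_norm _))// ltrDl.
by exists x => //=; rewrite in_itv.
Qed.

Lemma ge0_subset_Rintegral d (T : measurableType d) (R : realType)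
    (mu : {measure set T -> \bar R}) (A B : set T) (f : T -> R) :
  measurable A -> measurable B -> A `<=` B -> mu.-integrable B (EFin \o f) ->
  (forall x, B x -> 0 <= f x) ->
  \int[mu]_(x in A) f x <= \int[mu]_(x in B) f x.
Proof.
move=> mA mB AB fi f0; rewrite /Rintegral fine_le//.
- by apply: integrable_fin_num => //; exact: integrableS fi.
- exact: integrable_fin_num.
- by apply: ge0_subset_integral => //; exact: (measurable_int mu).
Qed.

Lemma itv_bounded_integrable (R : realType) (f : R -> R) (a b B : R) :
  measurable_fun (`[a, b] : set R) f -> (forall x, a <= x <= b -> `|f x| <= B) ->
  (@lebesgue_measure R).-integrable `[a, b] (EFin \o f).
Proof.
move=> mf fB; apply: measurable_bounded_integrable => //.
  exact/compact_finite_measure/segment_compact.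
exists B; split; first by rewrite num_real.
move=> M BM x /=; rewrite in_itv/= => xab; exact: le_trans (fB _ xab) (ltW BM).
Qed.

(** The nonnegativity of [u] keeps [(u, v)] inside the half plane on which [f] is
assumed continuous. *)
Lemma within_continuous_nonlinearity (R : realType) (f : R * R -> R) (u v : R -> R) :
  admissible_f f -> {within `[0, 1], continuous u} -> {within `[0, 1], continuous v} ->
  (forall t, 0 <= t <= 1 -> 0 <= u t) ->
  {within `[0, 1], continuous (fun s => f (u s, v s))}.
Proof.
move=> [/subspace_continuousP fc _] /subspace_continuousP uc /subspace_continuousP vc u0.
apply/subspace_continuousP => x x01.
have x01' : 0 <= x <= 1 by move: x01; rewrite /= in_itv.
have ux : (`[0, +oo[ `*` setT) (u x, v x) by split => //=; rewrite in_itv/= andbT u0.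
have cuv : (u s, v s) @[s --> within `[0, 1]%classic (nbhs x)] --> (u x, v x).
  exact: (cvg_pair (uc _ x01) (vc _ x01)).
move=> P /= /(fc _ ux) fP; have := cuv _ fP; rewrite /= /nbhs/= /within/=.
apply: filter_app; near=> s => h s01; apply: h => //.
by split => //=; rewrite in_itv/= andbT u0//; move: s01; rewrite /= in_itv.
Unshelve. all: by end_near.
Qed.

(** * The singular weight *)

Section weight.
Variables (R : realType) (n : nat) (R1 : R).
Hypotheses (n3 : (3 <= n)%N) (R10 : 0 < R1).

Let n2 : (2 : R) < n%:R. Proof. by rewrite ltr_nat. Qed.

(** The exponent [1 / (2 - n)] is negative, so [radius] is at least its value at
[s = 1]. *)
Lemma radius_ge (s : R) : 0 < s <= 1 -> R1 <= radius n R1 s.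
Proof.
move=> /andP[s0 s1]; rewrite /radius ler_peMr ?(ltW R10)//.
have -> : 1 / (2 - n%:R) = - (n%:R - 2)^-1 :> R by rewrite mul1r -opprB invrN.
rewrite powRN -[leLHS]invr1 lef_pV2 ?posrE ?powR_gt0//.
have p0 : 0 <= (n%:R - 2)^-1 :> R by rewrite invr_ge0 subr_ge0 ltW.
by have := ge0_ler_powR p0 (ltW s0) ler01 s1; rewrite powR1.
Qed.

(** The value [0] comes from the convention that a nonzero real power of [0] is
[0]; it lets all bounds on the weight be stated on the closed interval. *)
Lemma gweight0 (h : R -> R) : gweight n R1 h 0 = 0.
Proof.
rewrite /gweight /phi /radius powR0 ?mulr0 ?mul0r//.
by rewrite mul1r invr_neq0// subr_eq0 lt_eqF.
Qed.

Lemma phi_ge0 (s : R) : 0 <= phi n R1 s.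
Proof.
by rewrite /phi /radius !mulr_ge0 ?powR_ge0 ?invr_ge0 ?exprn_ge0 ?subr_ge0// ltW.
Qed.

Lemma gweight_ge0 (h : R -> R) (s : R) :
  (forall rho, R1 <= rho -> 0 <= h rho) -> 0 <= s <= 1 -> 0 <= gweight n R1 h s.
Proof.
move=> h0 /andP[]; rewrite le_eqVlt => /orP[/eqP <- _|s0 s1]; first by rewrite gweight0.
by rewrite /gweight mulr_ge0 ?phi_ge0// h0// radius_ge// s0.
Qed.

(** Comparison of the exponents of [s]:
[1 + 1 / (2 - n) + (2 * n - 3) / (2 - n) = n / (2 - n)]. *)
Lemma mul_phi (s : R) : 0 < s ->
  s * phi n R1 s * R1 ^+ n = R1 ^+ 2 / (n%:R - 2) ^+ 2 * radius n R1 s ^+ n.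
Proof.
move=> s0; have sn : s != 0 by rewrite gt_eqF.
have N2 : n%:R - 2 != 0 :> R by rewrite gt_eqF// subr_gt0.
have N2' : 2 - n%:R != 0 :> R by rewrite lt_eqF// subr_lt0.
rewrite /phi /radius exprMn -(@powR_mulrn _ (s `^ _)) ?powR_ge0// -powRrM.
have -> : 1 / (2 - n%:R) * n%:R = 1 + (1 / (2 - n%:R) + (2 * n%:R - 3) / (2 - n%:R)) :> R.
  by field.
rewrite powRD ?sn ?implybT// powRr1 ?ltW// powRD ?sn ?implybT//.
by field.
Qed.

(** By [mul_phi], it suffices to bound [rho ^ n * h rho] on [[R1, +oo[]: up to a
threshold by continuity of [h], beyond it because it is at most [rho ^ (- mu)]. *)
Lemma mul_gweight_bounded (h : R -> R) : admissible_h n R1 h ->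
  exists B, forall s, 0 <= s <= 1 -> s * gweight n R1 h s <= B.
Proof.
case=> hc h0 [mu mu0 [T [_ hT]]].
(* The decay holds strictly beyond [T]; a threshold at least [1] makes
   [rho ^ (- mu) <= 1]. *)
pose T' := Num.max 1 (T + 1).
have T'1 : 1 <= T' by rewrite le_max lexx.
have T'0 : 0 <= T' by rewrite (le_trans ler01).
have [B B0 hB] : exists2 B, 0 <= B & forall x, R1 <= x <= T' -> `|h x| <= B.
  apply: within_continuous_bounded; apply: continuous_subspaceW hc.
  by move=> x /=; rewrite !in_itv/= andbT => /andP[].
have rB rho : R1 <= rho -> rho ^+ n * h rho <= T' ^+ n * B + 1.
  move=> rR; have r0 : 0 <= rho by rewrite (le_trans _ rR)// ltW.
  have [rT|Tr] := leP rho T'.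
    apply: (@le_trans _ _ (T' ^+ n * B)); last by rewrite lerDl.
    apply: ler_pM; rewrite ?exprn_ge0 ?h0//.
      by rewrite lerXn2r ?nnegrE.
    by rewrite (le_trans (ler_norm _))// hB// rR.
  apply: (@le_trans _ _ 1); last by rewrite lerDr mulr_ge0// exprn_ge0.
  have r1 : 1 < rho by rewrite (le_lt_trans _ Tr).
  have Tr' : T < rho by move: Tr; rewrite gt_max => /andP[_]; lra.
  have := hT _ Tr' => hr.
  apply: (@le_trans _ _ (rho `^ n%:R * rho `^ (- (n%:R + mu)))).
    by rewrite powR_mulrn// ler_wpM2l// exprn_ge0.
  rewrite -powRD; last by rewrite (gt_eqF (lt_trans ltr01 r1)) implybT.
  by rewrite -[leRHS](powRr0 rho); apply: ler_powR; [lra|lra].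
pose C := R1 ^+ 2 / (n%:R - 2) ^+ 2.
have C0 : 0 <= C by rewrite mulr_ge0 ?invr_ge0 ?exprn_ge0 ?subr_ge0 ?ltW.
have bound0 : 0 <= C * (T' ^+ n * B + 1) / R1 ^+ n.
  apply: divr_ge0; last by rewrite exprn_ge0 ?ltW.
  by rewrite mulr_ge0// addr_ge0// mulr_ge0// exprn_ge0.
exists (C * (T' ^+ n * B + 1) / R1 ^+ n).
move=> s /andP[]; rewrite le_eqVlt => /orP[/eqP <- _|s0 s1]; first by rewrite mul0r.
rewrite ler_pdivlMr ?exprn_gt0// /gweight mulrA mulrAC mul_phi// -/C -(mulrA C).
by rewrite ler_wpM2l//; apply: rB; apply: radius_ge; rewrite s0.
Qed.

Lemma measurable_gweight (h : R -> R) : {within `[R1, +oo[, continuous h} ->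
  measurable_fun (`[0, 1] : set R) (gweight n R1 h).
Proof.
move=> hc; apply/measurable_fun_itv_obnd_cbndP.
have mr : measurable_fun [set: R] (radius n R1).
  by apply: measurable_funM => //; exact: measurable_powR.
apply: measurable_funM.
  apply: measurable_funTS; apply: measurable_funM; last exact: measurable_powR.
  by apply: measurable_funM.
apply: (@measurable_comp _ _ _ _ _ _ `[R1, +oo[) => //.
- by move=> _ [s /= + <-]; rewrite !in_itv/= andbT => ?; exact: radius_ge.
- exact: subspace_continuous_measurable_fun.
- exact: measurable_funTS.
Qed.

End weight.

(** * One component of the system *)

(** In this section [k] and [g] stand for a kernel and a weight of the system, and
[[a, b]] for the interval of the cone condition. *)

Section cone_component.
Variables (R : realType) (k : R -> R -> R) (g : R -> R) (a b c C B : R).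
Hypotheses (a0 : 0 < a) (ab : a <= b) (b1 : b <= 1) (c0 : 0 < c).
Hypotheses (k_bounds : kernel_bounds k a b c C)
  (mk : forall t, measurable_fun [set: R] (k t)).
Hypotheses (mg : measurable_fun (`[0, 1] : set R) g)
  (g0 : forall s : R, 0 <= s <= 1 -> 0 <= g s)
  (gB : forall s : R, 0 <= s <= 1 -> s * g s <= B).

Local Notation mu := (@lebesgue_measure R).
Local Notation mass := (\int[mu]_(s in `[a, b]) (s * (1 - s) * g s)).

Let sub01 s : a <= s <= b -> 0 <= s <= 1.
Proof. by move=> /andP[/(le_trans (ltW a0)) -> /le_trans ->]. Qed.

Let subset01 : `[a, b] `<=` `[(0 : R), 1].
Proof. by move=> s /=; rewrite !in_itv/=; exact: sub01. Qed.

Let B0 : 0 <= B.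
Proof. by have := @gB 0; rewrite mul0r lexx ler01; exact. Qed.

(* Read off the two bounds at [s = 1], where the lower one is [0]. *)
Let C0 : 0 <= C.
Proof.
have := @k_bounds a 1; rewrite lexx ab lexx ler01 => /(_ isT isT) /andP[+ +].
by rewrite subrr !mulr0 mulr1; exact: le_trans.
Qed.

(** The factor [s] in the upper bound of the kernel absorbs the singularity of
the weight at [0]. *)
Lemma kernel_weight_bounds t s : a <= t <= b -> 0 <= s <= 1 ->
  0 <= k t s * g s <= C * B.
Proof.
move=> tab s01; have /andP[kl ku] := k_bounds tab s01; have gs := g0 s01.
have k0 : 0 <= k t s.
  apply: le_trans kl; case/andP: s01 => s0 s1.
  by rewrite mulr_ge0 ?mulr_ge0 ?subr_ge0// ltW.
rewrite mulr_ge0//=; apply: (@le_trans _ _ (C * s * g s)); first exact: ler_wpM2r.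
by rewrite -mulrA ler_wpM2l// gB.
Qed.

Lemma kernel_weight_integrable (F : R -> R) (BF t : R) : a <= t <= b ->
  measurable_fun (`[0, 1] : set R) F -> (forall s, 0 <= s <= 1 -> 0 <= F s <= BF) ->
  mu.-integrable `[0, 1] (EFin \o (fun s => k t s * g s * F s)).
Proof.
move=> tab mF FB; apply: (@itv_bounded_integrable _ _ _ _ (C * B * BF)).
  by apply: measurable_funM => //; apply: measurable_funM => //; exact: measurable_funTS.
move=> s s01; have /andP[kg0 kgB] := kernel_weight_bounds tab s01.
by have /andP[F0 FBF] := FB _ s01; rewrite (ger0_norm (mulr_ge0 kg0 F0)) ler_pM.
Qed.

Let kg_integrable t : a <= t <= b ->
  mu.-integrable `[a, b] (EFin \o (fun s => k t s * g s)).
Proof.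
move=> tab; apply: (@integrableS _ _ _ mu `[0, 1] `[a, b] _ _ _ subset01) => //.
have := @kernel_weight_integrable (cst 1) 1 t tab (measurable_cst _).
rewrite (_ : (fun s => k t s * g s * cst 1 s) = (fun s => k t s * g s)).
  by apply => s _; rewrite /= lexx ler01.
by apply/funext => s; rewrite /= mulr1.
Qed.

Let mass_int : mu.-integrable `[a, b] (EFin \o (fun s => s * (1 - s) * g s)).
Proof.
apply: (@integrableS _ _ _ mu `[0, 1] `[a, b] _ _ _ subset01) => //.
apply: (@itv_bounded_integrable _ _ _ _ B).
  apply: measurable_funM => //; apply: measurable_funTS.
  by apply: measurable_funM => //; exact: measurable_funB.
move=> s s01; have gs := g0 s01; have gsB := gB s01.
case/andP: s01 => s0 s1.
rewrite ger0_norm ?mulr_ge0 ?subr_ge0//; apply: le_trans gsB.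
by rewrite ler_wpM2r// ler_piMr//; lra.
Qed.

(** Passes from the assumption on [Phi1] or [Phi2] to the normalised mass that
[kernel_bounds] sees. *)
Lemma mass_gt0 (Phi : R -> R) (q : R) : 0 < q ->
  (forall s, Phi s = q * (s * (1 - s))) ->
  0 < \int[mu]_(s in `[a, b]) (Phi s * g s) -> 0 < mass.
Proof.
move=> q0 PhiE.
have -> : (fun s => Phi s * g s) = (fun s => q * (s * (1 - s) * g s)).
  by apply/funext => s; rewrite PhiE -!mulrA.
by rewrite RintegralZl// pmulr_rgt0.
Qed.

Lemma kernel_integral_ge t : a <= t <= b ->
  c * mass <= \int[mu]_(s in `[a, b]) (k t s * g s).
Proof.
move=> tab.
rewrite -RintegralZl//; apply: le_Rintegral => //.
- exact: (@integrableZl _ _ _ mu _ _ c _ mass_int).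
- exact: kg_integrable.
- move=> s /=; rewrite in_itv/= => /sub01 s01.
  by rewrite mulrA ler_wpM2r ?g0//; case/andP: (k_bounds tab s01).
Qed.

Hypothesis massP : 0 < mass.

Local Notation M := (Mconst k g a b).

(** The infimum in [Mconst] is at least [c * mass > 0], so its inverse is
genuine; otherwise [Mconst] would be [0] by convention and the second conclusion
would fail. *)
Lemma Mconst_mul_ge1 :
  0 < M /\ forall t, a <= t <= b -> 1 <= M * \int[mu]_(s in `[a, b]) (k t s * g s).
Proof.
have lbI : lbound [set \int[mu]_(s in `[a, b]) (k t s * g s) | t in `[a, b]] (c * mass).
  by move=> x [t /=]; rewrite in_itv/= => tab <-; exact: kernel_integral_ge.
have inf_gt0 : 0 < inf [set \int[mu]_(s in `[a, b]) (k t s * g s) | t in `[a, b]].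
  apply: (@lt_le_trans _ _ (c * mass)); first by rewrite mulr_gt0.
  apply: lb_le_inf => //; exists (\int[mu]_(s in `[a, b]) (k a s * g s)).
  by exists a => //=; rewrite in_itv/= lexx.
split=> [|t tab]; first by rewrite /Mconst invr_gt0.
rewrite /Mconst ler_pdivlMl// mulr1; apply: ge_inf; first by exists (c * mass).
by exists t => //=; rewrite in_itv.
Qed.

(** As the integrand is nonnegative, the integral over the unit interval can be
restricted to [[a, b]], where [F] is bounded below. *)
Lemma kernel_operator_ge (F : R -> R) (BF m t : R) : a <= t <= b ->
  measurable_fun (`[0, 1] : set R) F -> (forall s, 0 <= s <= 1 -> 0 <= F s <= BF) ->
  (forall s, a <= s <= b -> m <= F s) ->
  m * \int[mu]_(s in `[a, b]) (k t s * g s)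
  <= \int[mu]_(s in `[0, 1]) (k t s * g s * F s).
Proof.
move=> tab mF FB mF'; have Fi := kernel_weight_integrable tab mF FB.
apply: (@le_trans _ _ (\int[mu]_(s in `[a, b]) (k t s * g s * F s))).
  rewrite -RintegralZl//; last exact: kg_integrable.
  apply: le_Rintegral => //.
  - exact: (@integrableZl _ _ _ mu _ _ m _ (kg_integrable tab)).
  - exact: integrableS Fi.
  - move=> s /=; rewrite in_itv/= => sab; rewrite mulrC ler_wpM2l ?mF'//.
    by case/andP: (kernel_weight_bounds tab (sub01 sab)).
apply: ge0_subset_Rintegral => // s /=; rewrite in_itv/= => s01.
case/andP: (FB _ s01) => F0 _; case/andP: (kernel_weight_bounds tab s01) => kg0 _.
exact: mulr_ge0.
Qed.

(** [F] stands for [f_i] along the solution, [H] for the value of the boundary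
functional, and [cg] for the product of [cgamma_i] with the norm of the profile.
If [sg] is the infimum of [w] over [[a, b]], the equation yields
[w t >= (cg * A + lam) * sg] for all [t] in [[a, b]], whence
[sg >= (cg * A + lam) * sg]. *)
Lemma no_cone_fixed_point (gamma w F : R -> R) (A lam cg H c' : R) :
  0 < A -> 0 < lam -> 0 <= cg -> (forall t, a <= t <= b -> cg <= gamma t) ->
  0 < c' -> c' * supnorm w <= inf [set w t | t in `[a, b]] -> 0 < supnorm w ->
  {within `[0, 1], continuous w} -> A * supnorm w <= H ->
  {within `[0, 1], continuous F} -> (forall s, 0 <= s <= 1 -> 0 <= F s) ->
  (forall s, 0 <= s <= 1 -> lam * M * w s <= F s) ->
  (forall t, a <= t <= b ->
     w t = gamma t * H + \int[mu]_(s in `[0, 1]) (k t s * g s * F s)) ->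
  ~ 1 < cg * A + lam.
Proof.
move=> A0 lam0 cg0 cg_gamma c'0 winf wpos wc HA Fc F0 FM weq q1.
have [Bw _ wB] := within_continuous_bounded wc.
have [BF _ FB] := within_continuous_bounded Fc.
have F0B s : 0 <= s <= 1 -> 0 <= F s <= BF.
  by move=> s01; rewrite F0//= (le_trans (ler_norm _))// FB.
have mF : measurable_fun (`[0, 1] : set R) F by exact: subspace_continuous_measurable_fun.
have [M0 M1] := Mconst_mul_ge1.
set sg := inf _ in winf; set q := cg * A + lam in q1.
have sg0 : 0 < sg by apply: lt_le_trans winf; rewrite mulr_gt0.
have wne : [set w t | t in `[a, b]] !=set0.
  by exists (w a); exists a => //=; rewrite in_itv/= lexx.
have sgw t : a <= t <= b -> sg <= w t.
  move=> tab; apply: ge_inf; last by exists t => //=; rewrite in_itv.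
  exists (- Bw) => x [s /=]; rewrite in_itv/= => sab <-.
  by have := wB _ (sub01 sab); rewrite ler_norml => /andP[].
have sg_norm : sg <= supnorm w.
  have aab : a <= a <= b by rewrite lexx.
  apply: le_trans (sgw _ aab) (le_trans (ler_norm _) _).
  exact: supnorm_ge wB (sub01 aab).
suff : q * sg <= sg by rewrite ger_pMl// leNgt q1.
apply: lb_le_inf => // x [t /=]; rewrite in_itv/= => tab <-.
rewrite weq// /q mulrDl; apply: lerD.
  rewrite -mulrA; apply: (@le_trans _ _ (cg * H)).
    by rewrite ler_wpM2l// (le_trans _ HA)// ler_wpM2l// ltW.
  rewrite ler_wpM2r ?cg_gamma//; apply: le_trans HA.
  by rewrite mulr_ge0// ltW.
(* The definition of [M] turns [lam * sg] into a multiple of the integral over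
   [[a, b]]. *)
apply: (@le_trans _ _ (lam * M * sg * \int[mu]_(s in `[a, b]) (k t s * g s))).
  have -> y : lam * M * sg * y = lam * sg * (M * y) by ring.
  by rewrite ler_peMr ?M1// mulr_ge0// ltW.
apply: (kernel_operator_ge tab mF F0B) => s sab.
apply: (le_trans _ (FM _ (sub01 sab))).
by rewrite ler_wpM2l ?sgw// mulr_ge0// ltW.
Qed.

End cone_component.

(** * The system *)

Theorem theorem2p13 (R : realType) (n : nat)
    (R1 Reta Rxi beta1 delta1 eta xi beta2 : R)
    (a1 b1 a2 b2 : R) (f1 f2 : R * R -> R) (h1 h2 : R -> R)
    (H1 H2 : funI R * funI R -> R)
    (A1 A2 lambda1 lambda2 : R) :
  let g1 := gweight n R1 h1 in
  let g2 := gweight n R1 h2 in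
  let K := cone beta1 beta2 eta xi a1 b1 a2 b2 in
  let M1 := Mconst (k1 beta1 eta) g1 a1 b1 in
  let M2 := Mconst (k2 beta2 xi) g2 a2 b2 in
  (3 <= n)%N -> 0 < R1 -> R1 < Reta -> R1 < Rxi ->
  0 < eta < 1 -> radius n R1 eta = Reta ->
  0 < xi < 1 -> radius n R1 xi = Rxi ->
  beta2 = (2 - n%:R) * delta1 * (xi / Rxi) ->
  1 <= beta1 < 1 / eta -> 0 <= beta2 < 1 - xi ->
  admissible_f f1 -> admissible_f f2 ->
  admissible_h n R1 h1 -> admissible_h n R1 h2 ->
  [/\ 0 < a1, a1 <= b1 & b1 <= 1] ->
  [/\ 0 < a2, a2 <= b2 & b2 < 1 - beta2] ->
  0 < \int[lebesgue_measure]_(s in `[a1, b1]) (Phi1 beta1 eta s * g1 s) ->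
  0 < \int[lebesgue_measure]_(s in `[a2, b2]) (Phi2 beta2 xi s * g2 s) ->
  compact_functional K H1 -> compact_functional K H2 ->
  0 < A1 -> 0 < A2 -> 0 < lambda1 -> 0 < lambda2 ->
  (forall u1 u2, K (u1, u2) -> H1 (u1, u2) >= A1 * supnorm u1) ->
  (forall u1 u2, K (u1, u2) -> H2 (u1, u2) >= A2 * supnorm u2) ->
  (forall z1 z2, 0 <= z1 -> f1 (z1, z2) >= lambda1 * M1 * z1) ->
  (forall z1 z2, 0 <= z1 -> f2 (z1, z2) >= lambda2 * M2 * z2) ->
  cgamma1 beta1 eta a1 * supnorm (gamma1 beta1 eta) * A1 + lambda1 > 1 ->
  cgamma2 beta2 b2 * supnorm (gamma2 beta2) * A2 + lambda2 > 1 ->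
  ~ exists u v : funI R,
      [/\ K (u, v),
          is_solution (k1 beta1 eta) (k2 beta2 xi) (gamma1 beta1 eta)
            (gamma2 beta2) g1 g2 f1 f2 H1 H2 u v
        & 0 < pairnorm (u, v)].
Proof.
move=> g1 g2 K M1 M2 n3 R10 _ _ eta01 _ xi01 _ _ beta1P beta2P f1a f2a h1a h2a.
move=> [a10 ab1 b11] [a20 ab2 b2b] Phi1P Phi2P _ _ A10 A20 l10 l20 HA1 HA2 F1 F2.
move=> q1 q2 [u [v [uvK sol]]]; have [[uc uge uinf] [vc vinf]] := uvK.
have u0 t : 0 <= t <= 1 -> 0 <= u t by move=> t01; apply: uge; rewrite in_itv.
have [[eta0 eta1] [beta10 _]] := (andP eta01, andP beta1P).
have [[xi0 xi1] [beta20 beta2xi]] := (andP xi01, andP beta2P).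
rewrite /pairnorm lt_max => /orP[unorm|vnorm].
- have D0 : 0 < 1 - beta1 * eta.
    by case/andP: beta1P => _; rewrite ltr_pdivlMr// subr_gt0.
  have cpos := c1_gt0 eta01 beta1P a10.
  have cg0 : 0 <= cgamma1 beta1 eta a1 * supnorm (gamma1 beta1 eta).
    rewrite mulr_ge0 ?supnorm_ge0//.
    by move: cpos; rewrite lt_min => /andP[_ /ltW].
  have [hc h0 _] := h1a; have [B gB] := mul_gweight_bounded n3 R10 h1a.
  have mg := measurable_gweight n3 R10 hc.
  have g_ge0 s := @gweight_ge0 R n R1 n3 R10 h1 s h0.
  have kb := k1_bounds eta01 beta1P a10 b11.
  have mass : 0 < \int[lebesgue_measure]_(s in `[a1, b1]) (s * (1 - s) * g1 s).
    apply: (mass_gt0 a10 b11 mg g_ge0 gB _ _ Phi1P (q := beta1 / (1 - beta1 * eta))).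
      by rewrite divr_gt0// (lt_le_trans ltr01 beta10).
    by move=> s; rewrite /Phi1; field; rewrite gt_eqF.
  apply: (no_cone_fixed_point (gamma := gamma1 beta1 eta) a10 ab1 b11 (mulr_gt0 a10 eta0) kb
    (measurable_k1 beta1 eta) mg g_ge0 gB mass A10 l10 cg0 _ cpos uinf unorm uc
    (HA1 _ _ uvK) (within_continuous_nonlinearity f1a uc vc u0) _ _ _ q1).
  + by move=> t /andP[a1t _]; exact: gamma1_ge.
  + by move=> s s01; apply: f1a.2; exact: u0.
  + by move=> s s01; apply: F1; exact: u0.
  + move=> t /andP[at_ tb]; have t01 : t \in `[0, 1].
      by rewrite in_itv/= (le_trans (ltW a10) at_) (le_trans tb b11).
    exact: (sol t t01).1.
- have D0 : 0 < 1 - beta2 by clear -xi0 beta2xi; lra.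
  have b21 : b2 <= 1 by clear -b2b beta20; lra.
  have cpos := c2_gt0 xi01 beta2P a20 ab2 b2b.
  have cg0 : 0 <= cgamma2 beta2 b2 * supnorm (gamma2 beta2).
    rewrite mulr_ge0 ?supnorm_ge0//.
    by move: cpos; rewrite lt_min => /andP[_ /ltW].
  have [hc h0 _] := h2a; have [B gB] := mul_gweight_bounded n3 R10 h2a.
  have mg := measurable_gweight n3 R10 hc.
  have g_ge0 s := @gweight_ge0 R n R1 n3 R10 h2 s h0.
  have kb := k2_bounds xi01 beta2P a20 b2b.
  have mass : 0 < \int[lebesgue_measure]_(s in `[a2, b2]) (s * (1 - s) * g2 s).
    apply: (mass_gt0 a20 b21 mg g_ge0 gB _ _ Phi2P
      (q := Num.max 1 (beta2 / xi) / (1 - beta2))).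
      by rewrite divr_gt0// lt_max ltr01.
    by move=> s; rewrite /Phi2; field; rewrite gt_eqF.
  have c0 : 0 < a2 * (1 - beta2 - xi) * (1 - beta2 - b2).
    rewrite mulr_gt0 ?subr_gt0// mulr_gt0// subr_gt0.
    by rewrite ltrBrDr addrC -ltrBrDr.
  apply: (no_cone_fixed_point (gamma := gamma2 beta2) a20 ab2 b21 c0 kb
    (measurable_k2 beta2 xi) mg g_ge0 gB mass A20 l20 cg0 _ cpos vinf vnorm vc
    (HA2 _ _ uvK) (within_continuous_nonlinearity f2a uc vc u0) _ _ _ q2).
  + by move=> t /andP[_ tb]; apply: gamma2_ge => //; rewrite beta20 -subr_gt0.
  + by move=> s s01; apply: f2a.2; exact: u0.
  + by move=> s s01; apply: F2; exact: u0.
  + move=> t /andP[at_ tb]; have t01 : t \in `[0, 1].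
      by rewrite in_itv/= (le_trans (ltW a20) at_) (le_trans tb b21).
    exact: (sol t t01).2.
Qed.
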